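(* Let $n\ge 1$ and let $A=\{a_1,\ldots,a_n\}$ be an alphabet of $n$ distinct nonzero elements of a field. For every $J=(j_1,\ldots,j_n)\in\mathbb{Z}^n$, $$\mathfrak{G}_J(A)=\det\Bigl(\mathfrak{G}_{0^{l-1},\,j_k+k-l,\,0^{n-l}}(A)\Bigr)_{1\le l,k\le n}.$$
   Context: For $J=(j_1,\ldots,j_n)\in\mathbb{Z}^n$, the generalized Schur function is $$\mathfrak{G}_J(A)=\frac{\det\bigl(a_k^{\,j_l+l-1}\bigr)_{1\le l,k\le n}}{\det\bigl(a_k^{\,l-1}\bigr)_{1\le l,k\le n}}.$$ The index $(0^{l-1},m,0^{n-l})\in\mathbb{Z}^n$ is the vector whose $l$-th entry is $m$ and whose other entries are $0$. In the determinant of the claim $l$ is the row index and $k$ the column index. *)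

(* Defs.v *)
From HB Require Import structures.
From mathcomp Require Import all_boot all_order all_algebra.
Set Implicit Arguments.
Unset Strict Implicit.
Unset Printing Implicit Defensive.
Import GRing.Theory.
Local Open Scope ring_scope.

(* Ordinals start at 0, so the exponent j_l + l - 1 of row l (l = 1..n) becomes
   J 0 l + l, and Vandermonde n a has a_k^(l-1) in (1-based) row l, column k.
   The exponent is an int: x ^ m is exprz, with x ^ (- m) = (x ^ m)^-1. *)
Definition gschur (F : fieldType) (n : nat) (J : 'rV[int]_n) (a : 'rV[F]_n) : F :=
  \det (\matrix_(l < n, k < n) a 0 k ^ (J 0 l + l%:Z)) / \det (Vandermonde n a).

Definition single_index (n : nat) (l : 'I_n) (m : int) : 'rV[int]_n :=
  \row_(i < n) (if i == l then m else 0).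

(* Main.v *)
Require Import Defs.
From mathcomp Require Import all_boot all_order all_algebra.
Import GRing.Theory.
Local Open Scope ring_scope.

(** With [V] the Vandermonde matrix of [a] and [E] the matrix of the powers
    [a_k ^ (J_l + l)], put [M = E V^-1], so that [\det M = \det E / \det V] is
    the generalized Schur function of [J].  Row [k] of [M] holds the
    coefficients that express the row [k] of [E] in the basis of [F^n] formed by
    the rows of [V]; by Cramer's rule its [l]-th entry is the quotient by
    [\det V] of the determinant of [V] with row [l] replaced by row [k] of [E].
    Replacing the exponent [l] by [J_k + k] amounts to adding [J_k + k - l] to
    it, so that quotient is a generalized Schur function whose index has
    at most one nonzero entry, and the matrix of the theorem is the transpose of
    [M]. *)

(** Cramer's rule for a row: the cofactors along row [l] do not see that row,
    so the Laplace expansion of the modified determinant pairs [u] with a column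
    of the adjugate of the original matrix. *)
Lemma det_replace_row (R : comPzRingType) (n : nat) (A : 'M[R]_n) (u : 'rV[R]_n)
    (l : 'I_n) :
  \det (\matrix_(i, j) if i == l then u 0 j else A i j) = (u *m \adj A) 0 l.
Proof.
rewrite (expand_det_row _ l) mxE; apply: eq_bigr => j _.
rewrite !mxE eqxx /cofactor; congr (_ * (_ * \det _)).
by apply/matrixP => i k; rewrite !mxE eq_sym (negPf (neq_lift l i)).
Qed.

Lemma Vandermonde_unitmx (F : fieldType) (n : nat) (a : 'rV[F]_n) :
  injective (a 0) -> Vandermonde n a \in unitmx.
Proof.
move=> a_inj; rewrite unitmxE unitfE det_Vandermonde.
apply/prodf_neq0 => i _; apply/prodf_neq0 => j lt_ij.
by rewrite subr_eq0 (inj_eq a_inj) neq_ltn lt_ij orbT.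
Qed.

(** The numerator on the left is the Vandermonde determinant with its row [l]
    replaced by the [m]-th powers, so by Cramer's rule the quotient is the
    coefficient of [x ^ l] in the polynomial of degree less than [n] that
    interpolates [x ^ m] at the points [a_j]. *)
Lemma gschur_single_index (F : fieldType) (n : nat) (a : 'rV[F]_n) (l : 'I_n)
    (m : int) :
  injective (a 0) ->
  gschur (single_index l (m - l%:Z)) a =
  ((\row_j a 0 j ^ m) *m invmx (Vandermonde n a)) 0 l.
Proof.
move=> a_inj; rewrite /invmx Vandermonde_unitmx // -scalemxAr [RHS]mxE.
rewrite -det_replace_row mulrC /gschur; congr (\det _ / _).
apply/matrixP => i j; rewrite !mxE.
by case: eqP => [-> | _]; rewrite ?subrK ?add0r.
Qed.

Theorem theorem3p4 (F : fieldType) (n : nat) (a : 'rV[F]_n) (J : 'rV[int]_n)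
    (hn : (0 < n)%N)
    (a_distinct : injective (a 0))
    (a_neq0 : forall k : 'I_n, a 0 k != 0) :
  gschur J a =
  \det (\matrix_(l < n, k < n)
          gschur (single_index l (J 0 k + k%:Z - l%:Z)) a).
Proof.
rewrite [LHS]/gschur -det_inv -det_mulmx -[LHS]det_tr.
congr (\det _); apply/matrixP => l k.
rewrite [RHS]mxE [LHS]mxE gschur_single_index // !mxE.
by apply: eq_bigr => j _; rewrite !mxE.
Qed.
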